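(* For $n\geq 2$, the number of permutations $\pi\in\mathcal{S}_n$ with at most one descent such that $\operatorname{des}(\pi^3)=0$ (i.e. $\pi^3$ is the identity) equals \[\binom{\lfloor\frac{n}{3}\rfloor+3}{3}+\binom{\lfloor\frac{n-1}{3}\rfloor+3}{3}+\binom{\lfloor\frac{n-2}{3}\rfloor+3}{3}-n,\] which equals $\frac12(k^3+4k^2-k+2)$ if $n=3k$, $\frac12(k^3+5k^2+2k+2)$ if $n=3k+1$, and $\frac12(k^3+6k^2+5k+2)$ if $n=3k+2$.
   Context: $\mathcal{S}_n$ is the symmetric group on $[n]$; a permutation $\pi=\pi_1\cdots\pi_n$ (one-line notation) has a descent at $i\in[n-1]$ if $\pi_i>\pi_{i+1}$, and $\operatorname{des}(\pi)$ is the number of descents. $\pi^3=\pi\circ\pi\circ\pi$. *)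

(* Defs.v *)
From mathcomp Require Import all_boot all_order all_fingroup all_algebra.

Set Implicit Arguments.
Unset Strict Implicit.
Unset Printing Implicit Defensive.

(* Positions and values are 0-based: [n] = {1, ..., n} is encoded as 'I_n.
   A position i is a descent only if the next position i.+1 exists. *)
Definition is_descent (n : nat) (p : 'S_n) (i : 'I_n) : bool :=
  [exists j : 'I_n, (j == i.+1 :> nat) && (p j < p i)].

Definition des (n : nat) (p : 'S_n) : nat := #|[set i : 'I_n | is_descent p i]|.

Lemma des_eq0 (n : nat) (p : 'S_n) : (des p == 0) = (p == 1%g).
Proof.
apply/idP/eqP => [|->]; last first.
  rewrite /des cards_eq0 -subset0; apply/subsetP => i; rewrite inE.
  by case/existsP => j /andP[/eqP ej]; rewrite !perm1 ej ltnNge leqnSn.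
rewrite /des cards_eq0 => /eqP d0.
have step (i j : 'I_n) : j = i.+1 :> nat -> p i < p j.
  move=> ej; rewrite ltnNge leq_eqVlt; apply/negP => /orP[/eqP/val_inj/perm_inj eji|lt].
    by move: (leqnn j); rewrite {1}ej eji ltnn.
  have : i \in [set i : 'I_n | is_descent p i].
    by rewrite inE; apply/existsP; exists j; rewrite ej eqxx.
  by rewrite d0 inE.
have mono d (i j : 'I_n) : j = i + d :> nat -> p i + d <= p j.
  elim: d j => [|d IH] j ej; first by move: ej; rewrite !addn0 => /val_inj->.
  have lt : i + d < n by move: (ltn_ord j); rewrite [X in X < _]ej addnS; apply: ltnW.
  rewrite addnS; apply: leq_ltn_trans (IH (Ordinal lt) erefl) (step _ _ _).
  by rewrite ej addnS.
apply/permP => i; rewrite perm1; apply/val_inj/eqP => /=.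
have n_gt0 : 0 < n := leq_ltn_trans (leq0n i) (ltn_ord i).
have lt_n : n.-1 < n by rewrite prednK.
have le_i : i <= n.-1 by rewrite -ltnS prednK.
rewrite eqn_leq; apply/andP; split.
  have := mono (n.-1 - i) i (Ordinal lt_n); rewrite subnKC // => /(_ erefl) h.
  have : p i + (n.-1 - i) <= i + (n.-1 - i).
    by rewrite subnKC //; apply: leq_trans h _; rewrite -ltnS prednK.
  by rewrite leq_add2r.
exact: leq_trans (leq_addl _ _) (mono i (Ordinal n_gt0) i erefl).
Qed.

(* Main.v *)
(* A pair (p, m), where p is a cube root of 1 that increases on the positions
   < m and on the positions >= m, is determined by the itineraries of its points:
   to x attach the binary word of length 3 whose letters say whether x, p x and
   p (p x) are >= m.  This word is weakly increasing in x and p rotates it, so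
   only its number of occurrences for 000, 001 and 011 matter; call these
   a, b, c.  Conversely every triple with a + 3 b + 3 c <= n comes from a pair
   (the Gessel-Reutenauer correspondence for cycle lengths 1 and 3).  The
   identity occurs with n + 1 values of m, every other such p with exactly one. *)
Require Import Defs.
From mathcomp Require Import all_boot all_order all_fingroup all_algebra.
From mathcomp Require Import zify ring.

Set Implicit Arguments.
Unset Strict Implicit.
Unset Printing Implicit Defensive.

Import Order.TTheory GRing.Theory Num.Theory.

Local Open Scope nat_scope.

(** * Counting the triples by iterated sums of binomials *)

(** Removing the term [c = 0] leaves the same sum for [t - 3], and by Pascal's rule the three
    binomials lose [t] in total. The bound on [t] ensures that no positive term is cut off. *)
Lemma sum_sub3 (N t : nat) : t <= 3 * N ->
  \sum_(c < N) (t - 3 * c) =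
    'C((t + 2) %/ 3 + 1, 2) + 'C((t + 1) %/ 3 + 1, 2) + 'C(t %/ 3 + 1, 2).
Proof.
elim: N t => [|N IH] t le_t; first by rewrite big_ord0; have -> : t = 0 by lia.
rewrite big_ord_recl /= muln0 subn0.
have [lt_t|le3t] := ltnP t 3.
  rewrite big1 => [|i _]; last by rewrite /bump /=; lia.
  by move: lt_t; case: t {le_t} => [|[|[|]]].
have [s def_t] : {s | t = s + 3} by exists (t - 3); lia.
transitivity (t + \sum_(c < N) (s - 3 * c)).
  by congr (_ + _); apply: eq_bigr => i _; rewrite /bump /=; lia.
rewrite IH; last lia.
have divD3 u : (s + 3 + u) %/ 3 = ((s + u) %/ 3).+1 by lia.
have divS3 : (s + 3) %/ 3 = (s %/ 3).+1 by lia.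
rewrite def_t !divD3 divS3 !addn1.
by rewrite !(binS _.+1 1) !bin1; lia.
Qed.

Lemma sum_sum_sub3 (N M t : nat) : t <= 3 * N -> t <= 3 * M ->
  \sum_(b < N) \sum_(c < M) (t - 3 * b - 3 * c) =
    'C((t + 2) %/ 3 + 2, 3) + 'C((t + 1) %/ 3 + 2, 3) + 'C(t %/ 3 + 2, 3).
Proof.
move=> le_tN le_tM; elim: N t le_tN le_tM => [|N IH] t le_tN le_tM.
  by rewrite big_ord0; have -> : t = 0 by lia.
rewrite big_ord_recl /= muln0 subn0 sum_sub3 //.
have [lt_t|le3t] := ltnP t 3.
  rewrite big1 => [|i _]; last by rewrite big1 // => j _; rewrite /bump /=; lia.
  by move: lt_t; case: t {le_tN le_tM} => [|[|[|]]].
have [s def_t] : {s | t = s + 3} by exists (t - 3); lia.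
transitivity ('C((t + 2) %/ 3 + 1, 2) + 'C((t + 1) %/ 3 + 1, 2)
    + 'C(t %/ 3 + 1, 2) + \sum_(b < N) \sum_(c < M) (s - 3 * b - 3 * c)).
  congr (_ + _); apply: eq_bigr => i _; apply: eq_bigr => j _.
  by rewrite /bump /=; lia.
rewrite IH; [|lia..].
have divD3 u : (s + 3 + u) %/ 3 = ((s + u) %/ 3).+1 by lia.
have divS3 : (s + 3) %/ 3 = (s %/ 3).+1 by lia.
rewrite def_t !divD3 divS3.
have binD q : 'C(q.+1 + 2, 3) = 'C(q + 2, 3) + 'C(q.+1 + 1, 2).
  by rewrite addSn binS addSnnS.
by rewrite !binD; lia.
Qed.

Lemma card_ord_lt (n k : nat) : k <= n -> #|[set x : 'I_n | x < k]| = k.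
Proof. by move=> le_k; rewrite cardsE -sum1_card big_ord_narrow ?sum1_card ?card_ord. Qed.

Definition triples (n : nat) : {set 'I_n.+1 * 'I_n.+1 * 'I_n.+1} :=
  [set t : 'I_n.+1 * 'I_n.+1 * 'I_n.+1 | t.1.1 + 3 * t.1.2 + 3 * t.2 <= n].

(** For fixed [b] and [c] there are [n.+1 - 3 * b - 3 * c] choices of [a]; truncated subtraction
    rightly gives 0 when [b] and [c] are too large. *)
Lemma card_triples (n : nat) : 2 <= n ->
  #|triples n| = 'C(n %/ 3 + 3, 3) + 'C((n - 1) %/ 3 + 3, 3) + 'C((n - 2) %/ 3 + 3, 3).
Proof.
move=> n_ge2.
have -> : n %/ 3 + 3 = (n.+1 + 2) %/ 3 + 2 by lia.
have -> : (n - 1) %/ 3 + 3 = (n.+1 + 1) %/ 3 + 2 by lia.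
have -> : (n - 2) %/ 3 + 3 = n.+1 %/ 3 + 2 by lia.
rewrite -(@sum_sum_sub3 n.+1 n.+1); [|lia..].
rewrite -sum1_card (eq_bigl (fun t : 'I_n.+1 * 'I_n.+1 * 'I_n.+1 =>
  t.1.1 + 3 * t.1.2 + 3 * t.2 <= n)); last first.
  by move=> t; rewrite inE.
rewrite big_mkcond /= -(pair_bigA _ (fun (ab : 'I_n.+1 * 'I_n.+1) (c : 'I_n.+1) =>
  if ab.1 + 3 * ab.2 + 3 * c <= n then 1 else 0)) /=.
rewrite -(pair_bigA _ (fun a b : 'I_n.+1 =>
  \sum_(c < n.+1) if a + 3 * b + 3 * c <= n then 1 else 0)) /=.
rewrite exchange_big; apply: eq_bigr => b _ /=.
rewrite exchange_big; apply: eq_bigr => c _ /=.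
rewrite -big_mkcond -[RHS](@card_ord_lt n.+1); last lia.
rewrite -sum1_card; apply: eq_bigl => a; rewrite inE; lia.
Qed.

(** * The block translation attached to a triple *)

(* The eight branches are the blocks of positions with words 000, 001, ..., 111
   (lengths a, b, b, c, b, c, c and the rest); each is translated onto the block
   of the rotated word. *)
Definition decode (a b c x : nat) : nat :=
  if x < a then x
  else if x < a + b then x + b
  else if x < a + 2 * b then x + b + c
  else if x < a + 2 * b + c then x + b + 2 * c
  else if x < a + 3 * b + c then x - (2 * b + c)
  else if x < a + 3 * b + 2 * c then x - (b + c)
  else if x < a + 3 * b + 3 * c then x - c
  else x.

(** The shifts along each of the block cycles 001, 010, 100 and 011, 110, 101 sum to zero. *)
Lemma decodeK3 a b c x : decode a b c (decode a b c (decode a b c x)) = x.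
Proof.
rewrite {3}/decode; do ![case: ifP => ?]; rewrite {2}/decode;
  (do ![case: ifP => ?]; try lia); rewrite /decode; do ![case: ifP => ?]; lia.
Qed.

Lemma decode_lt a b c n x : a + 3 * b + 3 * c <= n -> x < n -> decode a b c x < n.
Proof. by move=> *; rewrite /decode; do ![case: ifP => ?]; lia. Qed.

(** Rotation keeps the order of words with the same leading letter, so a descent can occur only
    where that letter changes from 0 to 1. *)
Lemma decode_ltS a b c x : x.+1 <> a + 2 * b + c -> decode a b c x < decode a b c x.+1.
Proof. by move=> ?; rewrite /decode; do ![case: ifP => ?]; lia. Qed.

Lemma decode_split a b c : decode a b c (a + 2 * b + c) = a.
Proof. by rewrite /decode; do ![case: ifP => ?]; lia. Qed.

Lemma decode_pred_split a b c : 0 < a + 2 * b + c ->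
  decode a b c (a + 2 * b + c).-1 = (a + 3 * b + 3 * c).-1.
Proof. by move=> ?; rewrite /decode; do ![case: ifP => ?]; lia. Qed.

(** * Permutations with a marked split *)

(** Here [m] is the length of the first run, hence the shift to [i.+1]; [m = 0] and [m = n] leave no
    room for a descent. *)
Definition descents_at (n : nat) (p : 'S_n) (m : nat) : bool :=
  [forall i : 'I_n, is_descent p i ==> (i.+1 == m)].

Lemma card_descents_at (n : nat) (p : 'S_n) :
  #|[set m : 'I_n.+1 | descents_at p m]| = if p == 1%g then n.+1 else (des p <= 1).
Proof.
case: ifPn => [|p_neq1].
  rewrite -des_eq0 cards_eq0 => /eqP des0.
  rewrite -[RHS]card_ord -cardsT; congr #|pred_of_set _|; apply/setP => m.
  rewrite !inE; apply/forallP => i; apply/implyP => di.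
  by have := in_set0 i; rewrite -des0 inE di.
have := p_neq1; rewrite -des_eq0 -lt0n => /card_gt0P[i]; rewrite inE => di.
have [le1|gt1] := leqP (des p) 1.
  have des_i j : is_descent p j -> j = i.
    by move=> dj; apply: (card_le1_eqP le1); rewrite inE.
  (* [lift ord0 i] is [i.+1] as an element of ['I_n.+1]. *)
  have -> : [set m : 'I_n.+1 | descents_at p m] = [set lift ord0 i].
    apply/setP => m; rewrite !inE -val_eqE /= /bump /= add1n eq_sym.
    apply/forallP/idP => [/(_ i)/implyP/(_ di) //|/eqP <- j].
    by apply/implyP => /des_i ->.
  by rewrite cards1.
apply/eqP; rewrite cards_eq0 -subset0; apply/subsetP => m; rewrite inE => /forallP at_m.
suff : des p <= 1 by rewrite leqNgt gt1.
apply/card_le1_eqP => j k; rewrite !inE => dj dk.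
have := implyP (at_m j) dj; have := implyP (at_m k) dk => /eqP ek /eqP ej.
by apply: val_inj => /=; lia.
Qed.

Definition split_cube_roots (n : nat) : {set 'S_n * 'I_n.+1} :=
  [set q : 'S_n * 'I_n.+1 | (q.1 ^+ 3 == 1)%g && descents_at q.1 q.2].

(** The identity contributes [n.+1] splits instead of one, whence the term [- n] of the final
    formula. *)
Lemma card_split_cube_roots (n : nat) :
  #|split_cube_roots n| =
    #|[set p : 'S_n | (des p <= 1) && (p ^+ 3 == 1)%g]| + n.
Proof.
have -> : #|split_cube_roots n| =
    \sum_(p : 'S_n | (p ^+ 3 == 1)%g) #|[set m : 'I_n.+1 | descents_at p m]|.
  rewrite -sum1_card; under [RHS]eq_bigr do rewrite -sum1_card.
  by rewrite pair_big_dep; apply: eq_bigl => q; rewrite !inE.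
have -> : #|[set p : 'S_n | (des p <= 1) && (p ^+ 3 == 1)%g]| =
    \sum_(p : 'S_n | (p ^+ 3 == 1)%g) (des p <= 1).
  rewrite -sum1_card big_mkcond [RHS]big_mkcond; apply: eq_bigr => p _.
  by rewrite inE; case: (des p <= 1); case: (_ == _).
rewrite (bigD1 1%g) ?expg1n //= [in RHS](bigD1 1%g) ?expg1n //=.
have /eqP -> : des (1%g : 'S_n) == 0 by rewrite des_eq0.
rewrite card_descents_at eqxx [LHS]addnC [1 + _]addnC -addnA add1n; congr (_ + _).
by apply: eq_bigr => p /andP[_ /negPf p1]; rewrite card_descents_at p1.
Qed.

(** * Monotonicity and itineraries *)

Lemma descents_at_mono (n : nat) (p : 'S_n) (m : nat) (x y : 'I_n) :
  descents_at p m -> x < y -> (m <= x) = (m <= y) -> p x < p y.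
Proof.
move=> /forallP at_m.
have step (i j : 'I_n) : j = i.+1 :> nat -> (m <= i) = (m <= j) -> p i < p j.
  move=> ej same; rewrite ltnNge leq_eqVlt; apply/negP => /orP[/eqP/val_inj/perm_inj eji|lt].
    by move: ej; rewrite eji; lia.
  have /(implyP (at_m i)) /eqP : is_descent p i by apply/existsP; exists j; rewrite ej eqxx.
  lia.
have mono d (i j : 'I_n) : j = i + d.+1 :> nat -> (m <= i) = (m <= j) -> p i < p j.
  elim: d j => [|d IH] j ej same; first by apply: step; rewrite // ej addn1.
  have lt : i + d.+1 < n by have := ltn_ord j; lia.
  by apply: ltn_trans (IH (Ordinal lt) erefl _) (step _ _ _ _) => /=; lia.
by move=> lt_xy; apply: (mono (y - x.+1)); lia.
Qed.

(** Sublevel sets of a weakly increasing [f] are initial segments, so their sizes determine [f]. *)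
Lemma lt_card_downset (n : nat) (f : 'I_n -> nat) (k : nat) (x : 'I_n) :
  (forall y z : 'I_n, y < z -> f y <= f z) ->
  (f x < k) = (x < #|[set z | f z < k]|).
Proof.
move=> f_mono; apply/idP/idP => [fx_lt|]; last first.
  apply: contraLR; rewrite -!leqNgt => le_k.
  rewrite -[leqRHS](@card_ord_lt n); last exact: ltnW.
  apply/subset_leq_card/subsetP => z; rewrite !inE !ltnNge; apply: contra.
  rewrite leq_eqVlt => /orP[/eqP/val_inj <- //|/f_mono]; exact: leq_trans.
rewrite -[leqLHS](@card_ord_lt n) //; apply/subset_leq_card/subsetP => z.
rewrite !inE ltnS leq_eqVlt => /orP[/eqP/val_inj -> //|/f_mono/leq_ltn_trans]; exact.
Qed.

(* The itinerary of x as a three-bit number, leading bit first. *)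
Definition word (n : nat) (p : 'S_n) (m : nat) (x : 'I_n) : nat :=
  4 * (m <= x) + 2 * (m <= p x) + (m <= p (p x)).

(** Cyclic left shift of three bits: the leading bit [w %/ 4] moves to the end. *)
Definition rotate (w : nat) : nat := 2 * (w %% 4) + w %/ 4.

Lemma word_lt8 (n : nat) (p : 'S_n) (m : nat) (x : 'I_n) : word p m x < 8.
Proof. rewrite /word; lia. Qed.

Lemma word_lt4 (n : nat) (p : 'S_n) (m : nat) (x : 'I_n) : (word p m x < 4) = (x < m).
Proof. rewrite /word; lia. Qed.

Lemma permX3 (T : finType) (p : {perm T}) (x : T) : p (p (p x)) = (p ^+ 3)%g x.
Proof. by rewrite !permX. Qed.

Lemma word_perm (n : nat) (p : 'S_n) (m : nat) (x : 'I_n) :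
  (p ^+ 3 = 1)%g -> word p m (p x) = rotate (word p m x).
Proof.
move=> p3; have -> : word p m (p x) = 4 * (m <= p x) + 2 * (m <= p (p x)) + (m <= x).
  by rewrite /word permX3 p3 perm1.
by rewrite /rotate /word; do 3!case: (m <= _).
Qed.

(** Words compare lexicographically: while the letters agree, both points lie on one side of [m],
    where [p] keeps their order. *)
Lemma word_mono (n : nat) (p : 'S_n) (m : nat) (x y : 'I_n) :
  descents_at p m -> x < y -> word p m x <= word p m y.
Proof.
move=> at_m lt_xy; rewrite /word.
have [same|] := eqVneq (m <= x) (m <= y); last lia.
have lt_p := descents_at_mono at_m lt_xy same.
have [same_p|] := eqVneq (m <= p x) (m <= p y); last lia.
have := descents_at_mono at_m lt_p same_p; lia.
Qed.

(* On equal words, [z] and [x] lie on the same side of [m], where [p] increases. *)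
Lemma perm_lt_word (n : nat) (p : 'S_n) (m : nat) (x z : 'I_n) :
  (p ^+ 3 = 1)%g -> descents_at p m ->
  (p z < p x) = (rotate (word p m z) < rotate (word p m x)) ||
    ((word p m z == word p m x) && (z < x)).
Proof.
move=> p3 at_m.
have lt_word (y t : 'I_n) : rotate (word p m y) < rotate (word p m t) -> p y < p t.
  rewrite -!word_perm // => lt_yt; rewrite ltnNge leq_eqVlt; apply/negP.
  move=> /orP[/eqP/val_inj eq_p|/(word_mono at_m)]; last by rewrite leqNgt lt_yt.
  by rewrite eq_p ltnn in lt_yt.
have lt_same (y t : 'I_n) : word p m y = word p m t -> y < t -> p y < p t.
  move=> eq_w lt_yt; apply: (descents_at_mono at_m) => //.
  by have := word_lt4 p m y; rewrite eq_w word_lt4; lia.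
have [eq_w|neq_w] /= := eqVneq (word p m z) (word p m x).
  rewrite eq_w ltnn /=; case: (ltngtP z x) => [lt_zx|lt_xz|/val_inj ->].
  - exact: lt_same.
  - by have := lt_same x z (esym eq_w) lt_xz; lia.
  - by rewrite ltnn.
(* [rotate] is injective below 8, so distinct words have distinct rotations and one of the two
   implications decides. *)
rewrite orbF; have := lt_word x z; have := lt_word z x.
have := word_lt8 p m x; have := word_lt8 p m z; rewrite /rotate; lia.
Qed.

(** The value at [x] is the number of [z] with a smaller image, and words alone decide which image
    is smaller. *)
Lemma perm_eq_word (n : nat) (p q : 'S_n) (m k : nat) :
  (p ^+ 3 = 1)%g -> descents_at p m -> (q ^+ 3 = 1)%g -> descents_at q k ->
  word p m =1 word q k -> p = q.
Proof.
move=> p3 at_m q3 at_k eq_w; apply/permP => x; apply: val_inj.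
have perm_rank (s : 'S_n) : s x = #|[set z | s z < s x]| :> nat.
  rewrite -[LHS](@card_ord_lt n); last exact: ltnW.
  rewrite -[LHS](card_preimset _ (@perm_inj _ s)); congr #|pred_of_set _|.
  by apply/setP => z; rewrite !inE.
rewrite /= perm_rank [RHS]perm_rank; congr #|pred_of_set _|; apply/setP => z.
by rewrite !inE (perm_lt_word _ _ p3 at_m) (perm_lt_word _ _ q3 at_k) !eq_w.
Qed.

Definition word_count (n : nat) (p : 'S_n) (m k : nat) : nat :=
  #|[set x | word p m x == k]|.

Lemma word_count_rotate (n : nat) (p : 'S_n) (m k : nat) :
  (p ^+ 3 = 1)%g -> k < 8 -> word_count p m (rotate k) = word_count p m k.
Proof.
move=> p3 k_lt8; rewrite /word_count -(card_preimset _ (@perm_inj _ p)).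
congr #|pred_of_set _|; apply/setP => x; rewrite !inE word_perm //.
have := word_lt8 p m x; rewrite /rotate; lia.
Qed.

Lemma card_word_lt (n : nat) (p : 'S_n) (m k : nat) :
  #|[set x | word p m x < k]| = \sum_(j < k) word_count p m j.
Proof.
elim: k => [|k IH]; first by rewrite big_ord0; apply: eq_card0 => x; rewrite inE.
rewrite big_ord_recr /= -IH /word_count -!sum1_card !(eq_bigl _ _ (in_set _)).
rewrite big_mkcond [X in X + _]big_mkcond [X in _ + X]big_mkcond -big_split.
by apply: eq_bigr => x _ /=; do ![case: ifP => ?]; lia.
Qed.

(** * The correspondence with triples *)

Definition encode (n : nat) (q : 'S_n * 'I_n.+1) : 'I_n.+1 * 'I_n.+1 * 'I_n.+1 :=
  (inord (word_count q.1 q.2 0), inord (word_count q.1 q.2 1),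
   inord (word_count q.1 q.2 3)).

Lemma word_count_le (n : nat) (p : 'S_n) (m k : nat) : word_count p m k < n.+1.
Proof. by rewrite ltnS -[leqRHS]card_ord max_card. Qed.

(** The rotation orbits are 1, 2, 4 and 3, 6, 5. *)
Lemma word_count_cube_root (n : nat) (p : 'S_n) (m : nat) (p3 : (p ^+ 3 = 1)%g) :
  [/\ word_count p m 2 = word_count p m 1, word_count p m 4 = word_count p m 1,
      word_count p m 5 = word_count p m 3 & word_count p m 6 = word_count p m 3].
Proof.
have rot := @word_count_rotate n p m _ p3.
by split; [exact: (rot 1)|rewrite -[RHS](rot 1) // -[RHS](rot 2)
  |rewrite -[RHS](rot 3) // -[RHS](rot 6)|exact: (rot 3)].
Qed.

Lemma encode_triples (n : nat) (q : 'S_n * 'I_n.+1) :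
  q \in split_cube_roots n -> encode q \in triples n.
Proof.
rewrite inE => /andP[/eqP p3 _].
rewrite inE /= !inordK ?word_count_le //.
have [e2 e4 e5 e6] := word_count_cube_root q.2 p3.
have : #|[set x | word q.1 q.2 x < 8]| <= n by rewrite -[leqRHS]card_ord max_card.
rewrite card_word_lt !big_ord_recr big_ord0 /= e2 e4 e5 e6; lia.
Qed.

(** Equal counts give equal sublevel sets of the words, hence equal words and equal permutations;
    the split is the number of words below 4. *)
Lemma encode_inj (n : nat) : {in split_cube_roots n &, injective (@encode n)}.
Proof.
move=> [p m] [q k]; rewrite !inE /= => /andP[/eqP p3 at_m] /andP[/eqP q3 at_k].
case=> /(congr1 (@nat_of_ord _)) + /(congr1 (@nat_of_ord _)) + /(congr1 (@nat_of_ord _)).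
rewrite !inordK ?word_count_le // => e0 e1 e3.
have [p2 p4 p5 p6] := word_count_cube_root m p3.
have [q2 q4 q5 q6] := word_count_cube_root k q3.
have eq_cum j : j <= 7 ->
    #|[set x | word p m x < j]| = #|[set x | word q k x < j]|.
  rewrite !card_word_lt => le_j; apply: eq_bigr => -[i lt_ij] _ /=.
  have : i < 7 by lia.
  case: i {lt_ij} => [|[|[|[|[|[|[|//]]]]]]] _; lia.
have eq_w : word p m =1 word q k.
  move=> x.
  have lt_eq j : j <= 7 -> (word p m x < j) = (word q k x < j).
    move=> /eq_cum eq_j; rewrite (lt_card_downset j x); last by move=> y z; apply: word_mono.
    rewrite eq_j -lt_card_downset // => y z; exact: word_mono.
  have := word_lt8 p m x; have := word_lt8 q k x.
  have := lt_eq (word p m x); have := lt_eq (word q k x); lia.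
rewrite (perm_eq_word p3 at_m q3 at_k eq_w); congr pair; apply: val_inj => /=.
have card_lt4 (s : 'S_n) (j : 'I_n.+1) : #|[set x | word s j x < 4]| = j.
  rewrite -[RHS](@card_ord_lt n); last by rewrite -ltnS.
  by congr #|pred_of_set _|; apply/setP => x; rewrite !inE word_lt4.
by rewrite -(card_lt4 p) eq_cum // card_lt4.
Qed.

Lemma decode_inj (n a b c a' b' c' : nat) :
  a + 3 * b + 3 * c <= n -> a' + 3 * b' + 3 * c' <= n ->
  a + 2 * b + c = a' + 2 * b' + c' ->
  (forall x, x < n -> decode a b c x = decode a' b' c' x) ->
  [/\ a = a', b = b' & c = c'].
Proof.
move=> le_n le_n' eq_m eq_f.
have eq_a : a = a'.
  (* If the split is at [n], then [b] and [c] vanish for both triples. *)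
  have [lt_n|] := ltnP (a + 2 * b + c) n; last lia.
  by have := eq_f _ lt_n; rewrite {2}eq_m !decode_split.
have eq_bc : a + 3 * b + 3 * c = a' + 3 * b' + 3 * c'.
  (* A split at 0 forces both triples to be zero; otherwise the value just before the split gives
     the sum. *)
  case: (posnP (a + 2 * b + c)) => [|gt0]; first lia.
  have lt_n : (a + 2 * b + c).-1 < n by lia.
  have := eq_f _ lt_n; rewrite {2}eq_m !decode_pred_split -?eq_m //; lia.
by split; lia.
Qed.

Lemma exists_decode (n : nat) (t : 'I_n.+1 * 'I_n.+1 * 'I_n.+1) :
  t \in triples n ->
  exists2 q, q \in split_cube_roots n &
    q.2 = t.1.1 + 2 * t.1.2 + t.2 :> nat /\
    forall x, q.1 x = decode t.1.1 t.1.2 t.2 x :> nat.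
Proof.
case: t => [[a b] c]; rewrite inE /= => le_n.
pose f (x : 'I_n) : 'I_n := Ordinal (decode_lt le_n (ltn_ord x)).
have f3 x : f (f (f x)) = x by apply: val_inj; rewrite /= decodeK3.
(* As [f] cubes to the identity, [f \o f] is its inverse. *)
have f_inj : injective f by apply: (can_inj (g := f \o f)) => x; rewrite /= f3.
have m_lt : a + 2 * b + c < n.+1 by lia.
exists (perm f_inj, Ordinal m_lt); last by split=> //= x; rewrite permE.
rewrite inE /=; apply/andP; split.
  by apply/eqP/permP => x; rewrite -permX3 !permE f3.
apply/forallP => i; apply/implyP => /existsP[j /andP[/eqP ej]].
rewrite !permE /= ej => lt_ji; apply/eqP.
have [//|/eqP /decode_ltS] := eqVneq i.+1 (a + 2 * b + c); lia.
Qed.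

(** Injections in both directions suffice, without checking that they are mutually inverse. *)
Lemma card_split_cube_roots_triples (n : nat) : #|split_cube_roots n| = #|triples n|.
Proof.
apply/eqP; rewrite eqn_leq; apply/andP; split.
  rewrite -(card_in_imset (@encode_inj n)); apply/subset_leq_card/subsetP => y.
  by case/imsetP => q q_in ->; apply: encode_triples.
have /fin_all_exists[g gP] (t : 'I_n.+1 * 'I_n.+1 * 'I_n.+1) :
    exists q : 'S_n * 'I_n.+1, t \in triples n ->
      [/\ q \in split_cube_roots n, q.2 = t.1.1 + 2 * t.1.2 + t.2 :> nat &
        forall x, q.1 x = decode t.1.1 t.1.2 t.2 x :> nat].
  have [/exists_decode[q q_in [q2 q1]]|] := boolP (t \in triples n); first by exists q.
  (* An arbitrary value outside [triples n]. *)
  by exists (1%g, ord0).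
have g_inj : {in triples n &, injective g}.
  move=> [[a b] c] [[a' b'] c'] t_in u_in eq_g; have [_ t2 t1] := gP _ t_in.
  have [_ u2 u1] := gP _ u_in; rewrite -{}eq_g in u1 u2.
  move: t_in u_in t1 t2 u1 u2; rewrite !inE /= => t_le u_le t1 t2 u1 u2.
  have [|x lt_xn|/val_inj-> /val_inj-> /val_inj-> //] := decode_inj t_le u_le.
    by rewrite -t2 u2.
  by rewrite -(t1 (Ordinal lt_xn)) u1.
rewrite -(card_in_imset g_inj); apply/subset_leq_card/subsetP => y.
by case/imsetP => t t_in ->; have [] := gP t t_in.
Qed.

(** * Closed formulas over the rationals *)

Local Open Scope ring_scope.

Lemma natr_bin3 (R : numFieldType) (k : nat) :
  'C(k + 3, 3)%:R = (k%:R + 1) * (k%:R + 2) * (k%:R + 3) / 6 :> R.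
Proof.
have : ('C(k + 3, 3) * 6 = (k + 1) * (k + 2) * (k + 3))%N.
  rewrite (bin_ffact _ 3) !ffactnS ffactn0; lia.
move=> /(congr1 (fun m => m%:R : R)); rewrite !natrM !natrD => e.
have six_neq0 : 6 != 0 :> R by rewrite pnatr_eq0.
by rewrite -[LHS](mulfK six_neq0); congr (_ / _).
Qed.

Theorem theorem3p1 (n : nat) (hn : (2 <= n)%N) :
  let count : rat :=
    #|[set p : 'S_n | (des p <= 1)%N && (des (p ^+ 3)%g == 0%N)]|%:R in
  let formula : rat :=
    'C((n %/ 3 + 3)%N, 3)%:R + 'C(((n - 1) %/ 3 + 3)%N, 3)%:R
      + 'C(((n - 2) %/ 3 + 3)%N, 3)%:R - n%:R in
  count = formula /\
  (forall k : nat,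
    [/\ n = (3 * k)%N ->
          formula = 1 / 2 * (k%:R ^+ 3 + 4 * k%:R ^+ 2 - k%:R + 2),
        n = (3 * k + 1)%N ->
          formula = 1 / 2 * (k%:R ^+ 3 + 5 * k%:R ^+ 2 + 2 * k%:R + 2)
      & n = (3 * k + 2)%N ->
          formula = 1 / 2 * (k%:R ^+ 3 + 6 * k%:R ^+ 2 + 5 * k%:R + 2)]).
Proof.
move=> count formula; split.
  rewrite /count /formula -!natrD -card_triples // -card_split_cube_roots_triples.
  rewrite card_split_cube_roots natrD addrK; congr (#|pred_of_set _|%:R).
  by apply/setP => p; rewrite !inE des_eq0.
move=> k; rewrite /formula !natr_bin3; split=> def_n.
(* Since [n >= 2], [k] is positive; writing it as [j.+1] expresses the smaller quotients without
   subtraction. *)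
- have [j def_k] : exists j, k = j.+1 by exists k.-1; lia.
  have -> : (n %/ 3 = j.+1)%N by lia.
  have -> : ((n - 1) %/ 3 = j)%N by lia.
  have -> : ((n - 2) %/ 3 = j)%N by lia.
  by rewrite def_n def_k natrM -natr1; field.
- have [j def_k] : exists j, k = j.+1 by exists k.-1; lia.
  have -> : (n %/ 3 = j.+1)%N by lia.
  have -> : ((n - 1) %/ 3 = j.+1)%N by lia.
  have -> : ((n - 2) %/ 3 = j)%N by lia.
  by rewrite def_n def_k natrD natrM -natr1; field.
- have -> : (n %/ 3 = k)%N by lia.
  have -> : ((n - 1) %/ 3 = k)%N by lia.
  have -> : ((n - 2) %/ 3 = k)%N by lia.
  by rewrite def_n natrD natrM; field.
Qed.
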